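(* Let $q\in\mathbb{C}$ with $0<|q|\le 1$, let $\alpha\in[0,\frac{\pi}{2})$, and let $A \in \prod_{q,\alpha}^n$. Then \begin{equation*} \frac{|q|^4\,\|AA^*+A^*A\|}{2\left(|q|^2+\left(|q|\sin(\alpha)+2\sqrt{1-|q|^2}\right)^2\right)}\le w_q^2(A). \end{equation*}
   Context: $M_n$ is the algebra of $n\times n$ complex matrices acting on $\mathbb{C}^n$ with inner product $\langle x,y\rangle=y^*x$ and operator norm $\|\cdot\|$. For $|q|\le 1$, $W_q(A)=\{\langle Ax,y\rangle : x,y\in\mathbb{C}^n,\ \|x\|=\|y\|=1,\ \langle x,y\rangle=q\}$ and $w_q(A)=\sup\{|z|: z\in W_q(A)\}$, with $w_q^2(A)=(w_q(A))^2$; it is understood that $W_q(A)$ is nonempty, i.e. $n\ge 1$ if $|q|=1$ and $n\ge 2$ if $|q|<1$. For $\alpha\in[0,\frac{\pi}{2})$ let $S_\alpha=\{z\in\mathbb{C}:\Re z>0,\ |\Im z|\le\tan(\alpha)\,\Re z\}$. A matrix $A\in M_n$ is $q$-sectorial if $W_q(A)\subseteq S_\alpha$ for some $\alpha\in[0,\frac{\pi}{2})$; $\prod_{q,\alpha}^n$ denotes the set of $A\in M_n$ with $W_q(A)\subseteq S_\alpha$. *)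

(* Defs.v *)
From HB Require Import structures.
From mathcomp Require Import all_boot all_order all_algebra.
From mathcomp Require Import complex.
From mathcomp Require Import all_classical all_reals all_analysis.

Set Implicit Arguments.
Unset Strict Implicit.
Unset Printing Implicit Defensive.

Import Order.TTheory GRing.Theory Num.Theory.

Local Open Scope classical_set_scope.
Local Open Scope ring_scope.
Local Open Scope sesquilinear_scope.

(* C^n is 'cV[R[i]]_n, and M ^t* is the conjugate transpose. [Normc.normc] is
   the modulus with values in R; the norm `|z| of R[i] has values in R[i]. *)

Definition inner (R : realType) (n : nat) (x y : 'cV[R[i]]_n) : R[i] :=
  ((y ^t*) *m x) 0 0.

Definition vnorm (R : realType) (n : nat) (x : 'cV[R[i]]_n) : R :=
  Num.sqrt (complex.Re (inner x x)).

(* The supremum is the operator norm when 0 < n: for n = 0 there is no unit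
   vector, and [sup set0 = 0]. *)
Definition opnorm (R : realType) (n : nat) (A : 'M[R[i]]_n) : R :=
  sup [set vnorm (A *m x) | x in [set x : 'cV[R[i]]_n | vnorm x = 1]].

Definition qrange (R : realType) (n : nat) (q : R[i]) (A : 'M[R[i]]_n) :
    set R[i] :=
  [set z | exists x y : 'cV[R[i]]_n,
    [/\ vnorm x = 1, vnorm y = 1, inner x y = q & z = inner (A *m x) y]].

Definition qradius (R : realType) (n : nat) (q : R[i]) (A : 'M[R[i]]_n) : R :=
  sup [set Normc.normc z | z in qrange q A].

Definition sector (R : realType) (alpha : R) : set R[i] :=
  [set z | 0 < complex.Re z /\
           `|complex.Im z| <= tan alpha * complex.Re z].

Definition qsectorial (R : realType) (n : nat) (q : R[i]) (alpha : R) :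
    set 'M[R[i]]_n :=
  [set A | qrange q A `<=` sector alpha].

(* Main.v *)
Require Import Defs.
From HB Require Import structures.
From mathcomp Require Import all_boot all_order all_algebra.
From mathcomp Require Import complex.
From mathcomp Require Import all_classical all_reals all_analysis.
From mathcomp Require Import ring lra.

Set Implicit Arguments.
Unset Strict Implicit.
Unset Printing Implicit Defensive.

Import Order.TTheory GRing.Theory Num.Theory.

Local Open Scope classical_set_scope.
Local Open Scope ring_scope.
Local Open Scope sesquilinear_scope.

(** Write r = |q|, s = sqrt (1 - r^2), w = w_q(A) and B = qA.

    For a unit vector x choose z orthogonal to x with |z|^2 = 1 - r^2. The two
    unit vectors y = conj(q) x + z and y = conj(q) x - z both satisfy
    <x, y> = q, and the corresponding points <Ax, y> of W_q(A) are
    <Bx, x> + <Ax, z> and <Bx, x> - <Ax, z> ([qrange_pair]). Both lie in the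
    sector and in the disc of radius w, hence both have |Re| <= w and
    |Im| <= w sin(alpha) ([sector_Im_le]). Their midpoint <Bx, x> inherits
    these bounds, whatever the value of <Ax, z> is.

    It remains to treat the ordinary numerical range of B. The real and
    imaginary parts of <Bx, x> are the quadratic forms of the Hermitian
    matrices (B + B^* )/2 and (B - B^* )/(2i), and the norm of a Hermitian
    matrix is the bound of its quadratic form ([selfadjoint_norm_le]). With
    the parallelogram identity
      |Bx + B^*x|^2 + |Bx - B^*x|^2 = 2 (|Bx|^2 + |B^*x|^2)
    this gives |Bx|^2 + |B^*x|^2 <= 2 w^2 (1 + sin(alpha)^2) on unit vectors
    ([cartesian_bound]). The left side is the quadratic form of the Hermitian
    matrix BB^* + B^*B = r^2 (AA^* + A^*A), so, using once more that the norm
    of a Hermitian matrix is read off its quadratic form,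
      r^2 |AA^* + A^*A| <= 2 w^2 (1 + sin(alpha)^2).
    The theorem follows since
    r^2 (1 + sin(alpha)^2) <= r^2 + (r sin(alpha) + 2 s)^2. *)

Local Notation Re := complex.Re.
Local Notation Im := complex.Im.

(** * Real and imaginary parts, moduli *)

Lemma ReD (R : realType) (a b : R[i]) : Re (a + b) = Re a + Re b.
Proof. by case: a; case: b. Qed.

Lemma ImD (R : realType) (a b : R[i]) : Im (a + b) = Im a + Im b.
Proof. by case: a; case: b. Qed.

Lemma ReN (R : realType) (a : R[i]) : Re (- a) = - Re a.
Proof. by case: a. Qed.

Lemma ImN (R : realType) (a : R[i]) : Im (- a) = - Im a.
Proof. by case: a. Qed.

Lemma ReZ (R : realType) (t : R) (a : R[i]) : Re (t%:C%C * a) = t * Re a.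
Proof. by case: a => a b /=; rewrite mul0r subr0. Qed.

Lemma Re_mulNi (R : realType) (a : R[i]) : Re (- 'i%C * a) = Im a.
Proof. by case: a => a b /=; ring. Qed.

Lemma Re_conj (R : realType) (a : R[i]) : Re (Num.conj a) = Re a.
Proof. by case: a. Qed.

Lemma conj_real (R : realType) (t : R) : Num.conj (t%:C%C : R[i]) = t%:C%C.
Proof. exact: conjc_real. Qed.

Lemma conj_i (R : realType) : Num.conj ('i%C : R[i]) = - 'i%C.
Proof. by apply/eqP; rewrite eq_complex /= oppr0 !eqxx. Qed.

Lemma normc_norm (R : realType) (z : R[i]) : (Normc.normc z)%:C%C = `|z|.
Proof. by []. Qed.

Lemma Re_le_normc (R : realType) (z : R[i]) : `|Re z| <= Normc.normc z.
Proof. by rewrite -lecR normc_norm normc_ge_Re. Qed.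

Lemma normc_ge0 (R : realType) (z : R[i]) : 0 <= Normc.normc z.
Proof. by rewrite -ler0c normc_norm. Qed.

Lemma normc_conj (R : realType) (z : R[i]) :
  Normc.normc (Num.conj z) = Normc.normc z.
Proof. by apply: complexI; rewrite !normc_norm norm_conjC. Qed.

Lemma normc_i (R : realType) : Normc.normc ('i%C : R[i]) = 1.
Proof. by rewrite /Normc.normc /= expr0n expr1n add0r sqrtr1. Qed.

(** * The complex inner product *)

Section Inner.
Variables (R : realType) (n : nat).
Implicit Types (x y z : 'cV[R[i]]_n) (A : 'M[R[i]]_n) (c : R[i]).

Lemma innerE x y : inner x y = \sum_i Num.conj (y i 0) * x i 0.
Proof. by rewrite /inner mxE; apply: eq_bigr => i _; rewrite !mxE. Qed.

Lemma innerDl x y z : inner (x + y) z = inner x z + inner y z.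
Proof. by rewrite /inner mulmxDr mxE. Qed.

Lemma innerZl c x z : inner (c *: x) z = c * inner x z.
Proof. by rewrite /inner -scalemxAr mxE. Qed.

Lemma inner_conj x y : inner y x = Num.conj (inner x y).
Proof.
rewrite !innerE raddf_sum /=; apply: eq_bigr => i _.
by rewrite rmorphM /= conjCK mulrC.
Qed.

Lemma innerDr x y z : inner x (y + z) = inner x y + inner x z.
Proof. by rewrite inner_conj innerDl rmorphD /= -!inner_conj. Qed.

Lemma innerZr c x z : inner x (c *: z) = Num.conj c * inner x z.
Proof. by rewrite inner_conj innerZl rmorphM /= -inner_conj. Qed.

Lemma inner_adjoint A x y : inner (A *m x) y = inner x (A ^t* *m y).
Proof. by rewrite /inner trmx_mul map_mxM trmxCK mulmxA. Qed.

Lemma inner_ge0 x : 0 <= inner x x.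
Proof.
by rewrite innerE; apply: sumr_ge0 => i _; rewrite -normCKC exprn_ge0.
Qed.

Lemma inner_eq0 x : (inner x x == 0) = (x == 0).
Proof.
apply/idP/eqP => [|->]; last by rewrite /inner mulmx0 mxE.
rewrite innerE psumr_eq0 => [/allP xi0|i _]; last by rewrite -normCKC exprn_ge0.
apply/colP => i; rewrite mxE; apply/eqP.
by have := xi0 i (mem_index_enum _); rewrite -normCKC expf_eq0 normr_eq0.
Qed.

End Inner.

(** * The underlying real inner product *)

(** The norm and the real part of a quadratic form only depend on the real
    Euclidean structure of C^n, in which Hermitian matrices are symmetric
    operators. The definition is locked so that rewriting with bilinearity does
    not unfold it into a sum of products. *)
HB.lock Definition rinner (R : realType) (n : nat) (x y : 'cV[R[i]]_n) : R :=
  Re (inner x y).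

Section RealInner.
Variables (R : realType) (n : nat).
Implicit Types (x y z : 'cV[R[i]]_n) (A H : 'M[R[i]]_n) (c : R[i]) (t h k : R).

Lemma rinnerDl x y z : rinner (x + y) z = rinner x z + rinner y z.
Proof. by rewrite !unlock innerDl ReD. Qed.

Lemma rinnerC x y : rinner x y = rinner y x.
Proof. by rewrite !unlock inner_conj Re_conj. Qed.

Lemma rinnerDr x y z : rinner x (y + z) = rinner x y + rinner x z.
Proof. by rewrite rinnerC rinnerDl !(rinnerC x). Qed.

Lemma rinnerZl t x y : rinner (t%:C%C *: x) y = t * rinner x y.
Proof. by rewrite !unlock innerZl ReZ. Qed.

Lemma rinnerZr t x y : rinner x (t%:C%C *: y) = t * rinner x y.
Proof. by rewrite rinnerC rinnerZl rinnerC. Qed.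

Lemma rinnerNl x y : rinner (- x) y = - rinner x y.
Proof. by rewrite -scaleN1r -(rmorphN1 (real_complex R)) rinnerZl mulN1r. Qed.

Lemma rinnerNr x y : rinner x (- y) = - rinner x y.
Proof. by rewrite rinnerC rinnerNl rinnerC. Qed.

Lemma rinner0l x : rinner 0 x = 0.
Proof.
by rewrite -(scale0r (0 : 'cV_n)) -(rmorph0 (real_complex R)) rinnerZl
  mul0r.
Qed.

Lemma rinnerZ c x y :
  rinner (c *: x) (c *: y) = Normc.normc c ^+ 2 * rinner x y.
Proof.
rewrite !unlock innerZl innerZr mulrA -normCK -normc_norm -rmorphXn.
by rewrite ReZ.
Qed.

Lemma rinner_adjoint A x y : rinner (A *m x) y = rinner x (A ^t* *m y).
Proof. by rewrite !unlock inner_adjoint. Qed.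

Lemma adjointK A : (A ^t*) ^t* = A.
Proof. exact: trmxCK. Qed.

Lemma inner_real x : inner x x = (rinner x x)%:C%C.
Proof. by rewrite unlock RRe_real // ger0_real // inner_ge0. Qed.

Lemma rinner_ge0 x : 0 <= rinner x x.
Proof. by rewrite -ler0c -inner_real inner_ge0. Qed.

Lemma rinner_eq0 x : (rinner x x == 0) = (x == 0).
Proof. by rewrite -inner_eq0 inner_real (inj_eq (@complexI R)). Qed.

Lemma vnormE x : vnorm x = Num.sqrt (rinner x x).
Proof. by rewrite unlock. Qed.

Lemma vnorm_unit x : vnorm x = 1 <-> rinner x x = 1.
Proof.
rewrite vnormE; split=> [/(congr1 (fun t => t ^+ 2))|->]; last exact: sqrtr1.
by rewrite sqr_sqrtr ?rinner_ge0 // expr1n.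
Qed.

Lemma unit_decomposition x : x != 0 ->
  exists t u, rinner u u = 1 /\ x = t%:C%C *: u.
Proof.
rewrite -rinner_eq0 => x0; set s := Num.sqrt (rinner x x).
have ss : s * s = rinner x x by rewrite -expr2 sqr_sqrtr ?rinner_ge0.
have s0 : s != 0 by apply: contraNneq x0 => s0; rewrite -ss s0 mulr0.
exists s, (s^-1%:C%C *: x); rewrite rinnerZl rinnerZr -ss; split.
  by field.
by rewrite scalerA -rmorphM /= mulfV // scale1r.
Qed.

Lemma quadratic_bound A h x :
  (forall u, rinner u u = 1 -> `|rinner (A *m u) u| <= h) ->
  `|rinner (A *m x) x| <= h * rinner x x.
Proof.
move=> Ah; have [->|/unit_decomposition[t [u [u1 ->]]]] := eqVneq x 0.
  by rewrite mulmx0 !rinner0l normr0 mulr0.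
rewrite -scalemxAr !(rinnerZl, rinnerZr) u1 mulr1 mulrA -expr2 normrM.
by rewrite ger0_norm ?sqr_ge0 // mulrC ler_wpM2r ?sqr_ge0 // Ah.
Qed.

(** * Norm and quadratic form of a Hermitian matrix *)

(** Polarization: 4 Re <Hx, y> is the difference of the quadratic form at x + y
    and at x - y, and |x + y|^2 + |x - y|^2 = 2 (|x|^2 + |y|^2). *)
Lemma selfadjoint_polarization H h x y : H ^t* = H ->
  (forall u, rinner u u = 1 -> `|rinner (H *m u) u| <= h) ->
  2 * rinner (H *m x) y <= h * (rinner x x + rinner y y).
Proof.
move=> HH Hh.
have Hp := le_trans (ler_norm _) (quadratic_bound (x + y) Hh).
have := quadratic_bound (x - y) Hh; rewrite ler_norml => /andP[Hm _].
have Hyx : rinner (H *m y) x = rinner (H *m x) y.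
  by rewrite rinner_adjoint HH rinnerC.
move: Hp Hm; rewrite !mulmxDr !mulmxN.
rewrite !(rinnerDl, rinnerDr, rinnerNl, rinnerNr) Hyx (rinnerC y x).
lra.
Qed.

(** Take y = t Hx in the polarized bound. The resulting inequality
    2 t |Hx|^2 <= h (|x|^2 + t^2 |Hx|^2) is sharpest at t = 1/h;
    when h = 0, taking t = 1 already gives Hx = 0. *)
Lemma selfadjoint_norm_le H h x : H ^t* = H ->
  (forall u, rinner u u = 1 -> `|rinner (H *m u) u| <= h) ->
  rinner (H *m x) (H *m x) <= h ^+ 2 * rinner x x.
Proof.
move=> HH Hh.
have [->|x0] := eqVneq x 0; first by rewrite mulmx0 !rinner0l mulr0.
have h0 : 0 <= h.
  by have [_ [u [u1 _]]] := unit_decomposition x0; apply: le_trans (Hh u u1).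
have key t : 2 * t * rinner (H *m x) (H *m x)
    <= h * (rinner x x + t ^+ 2 * rinner (H *m x) (H *m x)).
  have := selfadjoint_polarization x (t%:C%C *: (H *m x)) HH Hh.
  by rewrite !rinnerZr rinnerZl !mulrA.
move: (rinner (H *m x) (H *m x)) (rinner x x) key => N X key.
have [h00|hn0] := eqVneq h 0; first by have := key 1; rewrite h00; lra.
have hp : 0 < h by rewrite lt_def hn0.
have := ler_wpM2l (ltW hp) (key h^-1).
have -> : h * (2 * h^-1 * N) = 2 * N by field.
have -> : h * (h * (X + h^-1 ^+ 2 * N)) = h ^+ 2 * X + N by field.
lra.
Qed.

(** * Cartesian decomposition *)

Lemma hermitian_part_bound A h x :
  (forall u, rinner u u = 1 -> `|rinner (A *m u) u| <= h) ->
  rinner (A *m x + A ^t* *m x) (A *m x + A ^t* *m x)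
    <= (2 * h) ^+ 2 * rinner x x.
Proof.
move=> Ah; rewrite -mulmxDl; apply: selfadjoint_norm_le => [|u u1].
  by rewrite linearD /= map_mxD adjointK addrC.
have -> : rinner ((A + A ^t*) *m u) u = 2 * rinner (A *m u) u.
  rewrite mulmxDl rinnerDl (rinner_adjoint (A ^t*)) adjointK (rinnerC u).
  by rewrite mulr_natl mulr2n.
by rewrite normrM ger0_norm // ler_wpM2l // Ah.
Qed.

(** The imaginary part of <Ax, x> is the real part of <-iAx, x>, so the bound
    on Hermitian parts applies to both A and -iA. Adding the two estimates, the
    cross terms <Ax, A^*x> cancel. *)
Lemma cartesian_bound A h k x :
  (forall u, rinner u u = 1 -> `|Re (inner (A *m u) u)| <= h) ->
  (forall u, rinner u u = 1 -> `|Im (inner (A *m u) u)| <= k) ->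
  rinner (A *m x) (A *m x) + rinner (A ^t* *m x) (A ^t* *m x)
    <= 2 * (h ^+ 2 + k ^+ 2) * rinner x x.
Proof.
move=> Ah Ak.
have Hh : rinner (A *m x + A ^t* *m x) (A *m x + A ^t* *m x)
    <= (2 * h) ^+ 2 * rinner x x.
  by apply: hermitian_part_bound => u /Ah; rewrite unlock.
have Hk : rinner ('i%C *: (- (A *m x) + A ^t* *m x))
                 ('i%C *: (- (A *m x) + A ^t* *m x))
    <= (2 * k) ^+ 2 * rinner x x.
  rewrite scalerDr scalerN -scaleNr !scalemxAl.
  have <- : (- 'i%C *: A) ^t* = 'i%C *: A ^t*.
    by rewrite linearZ /= map_mxZ rmorphN /= conj_i opprK.
  apply: hermitian_part_bound => u /Ak; rewrite -scalemxAl unlock innerZl.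
  by rewrite Re_mulNi.
move: Hh Hk; rewrite rinnerZ normc_i expr1n mul1r.
rewrite !(rinnerDl, rinnerDr, rinnerNl, rinnerNr).
rewrite (rinnerC (A ^t* *m x) (A *m x)); lra.
Qed.

(** AA^* + A^*A is Hermitian, with quadratic form |Ax|^2 + |A^*x|^2. *)
Lemma opnorm_anticommutator_le A h :
  (forall u, rinner u u = 1 ->
     rinner (A *m u) (A *m u) + rinner (A ^t* *m u) (A ^t* *m u) <= h) ->
  0 <= h -> opnorm (A *m (A ^t*) + (A ^t*) *m A) <= h.
Proof.
move=> Ah h0; set M := _ + _.
rewrite /opnorm; set S := [set _ | _ in _].
have [->|/set0P S0] := eqVneq S set0; first by rewrite sup0.
apply: ge_sup => // _ [x /vnorm_unit x1 <-].
have MM : M ^t* = M by rewrite linearD /= map_mxD !trmx_mul !map_mxM !trmxCK.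
have Mh u : rinner u u = 1 -> `|rinner (M *m u) u| <= h.
  move=> /Ah le_h; rewrite mulmxDl rinnerDl -!mulmxA (rinner_adjoint A).
  rewrite (rinner_adjoint (A ^t*) (A *m u)) adjointK ger0_norm => [|].
    by rewrite addrC.
  by rewrite addr_ge0 ?rinner_ge0.
have := selfadjoint_norm_le x MM Mh; rewrite x1 mulr1 vnormE => le2.
by rewrite -(ger0_norm h0) -sqrtr_sqr ler_wsqrtr.
Qed.

(** * The q-numerical range *)

Lemma unit_entry_le1 x i : rinner x x = 1 -> `|x i 0| <= 1.
Proof.
move=> x1; rewrite -(@expr_le1 _ 2) //.
have <- : inner x x = 1 by rewrite inner_real x1.
rewrite innerE (bigD1 i) //= -normCKC lerDl.
by apply: sumr_ge0 => j _; rewrite -normCKC exprn_ge0.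
Qed.

(** The supremum defining the q-numerical radius dominates the moduli of the
    points of W_q(A) only because they are bounded; the sum of the moduli of the
    entries of A is a bound, since unit vectors have entries of modulus at
    most 1. *)
Lemma qrange_bounded q A : has_ubound [set Normc.normc z | z in qrange q A].
Proof.
exists (Re (\sum_i \sum_j `|A i j|)).
move=> _ [_ [x [y [/vnorm_unit x1 /vnorm_unit y1 _ ->]]] <-].
rewrite -lecR normc_norm RRe_real; last first.
  by rewrite ger0_real // !sumr_ge0 // => i _; rewrite sumr_ge0.
rewrite innerE (le_trans (ler_norm_sum _ _ _)) // ler_sum // => i _.
rewrite normrM norm_conjC mxE.
rewrite -[leRHS]mul1r ler_pM ?unit_entry_le1 //.
rewrite (le_trans (ler_norm_sum _ _ _)) // ler_sum // => j _.
by rewrite normrM ler_piMr ?unit_entry_le1.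
Qed.

(** A column x has rank at most 1 < n, so some nonzero row v has v x = 0; then
    u is v^* normalized. *)
Lemma orthogonal_vector x : (1 < n)%N ->
  exists u, rinner u u = 1 /\ inner x u = 0.
Proof.
move=> n1.
have : kermx x != 0.
  rewrite kermx_eq0 /row_free neq_ltn (leq_ltn_trans (rank_leq_col _)) //.
case/rowV0Pn => v /sub_kermxP vx v0.
have : v ^t* != 0.
  by apply: contraNneq v0 => v0; rewrite -(trmxCK v) v0 trmx0 map_mx0.
case/unit_decomposition => t [u [u1 vu]]; exists u; split=> //.
have : inner x (v ^t*) = 0 by rewrite /inner trmxCK vx mxE.
rewrite vu innerZr conj_real => /eqP; rewrite mulf_eq0 => /orP[|/eqP //].
move=> /eqP t0; move: v0; rewrite -(trmxCK v) vu t0 scale0r trmx0 map_mx0.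
by rewrite eqxx.
Qed.

(** The values <qAx, x> of the ordinary numerical range are midpoints of pairs
    of points of W_q(A). When |q| = 1 the two points coincide, with d = 0. *)
Lemma qrange_pair q A x :
  Normc.normc q <= 1 -> (Normc.normc q < 1 -> (1 < n)%N) -> rinner x x = 1 ->
  exists d : R[i], qrange q A (inner ((q *: A) *m x) x + d) /\
                   qrange q A (inner ((q *: A) *m x) x - d).
Proof.
move=> q1 qn x1; set r := Normc.normc q in q1 qn *.
have r0 : 0 <= r by exact: normc_ge0.
have xx : inner x x = 1 by rewrite inner_real x1.
have [z [xz zz]] : exists z, inner x z = 0 /\ inner z z = (1 - r ^+ 2)%:C%C.
  have [req1|rn1] := eqVneq r 1.
    exists 0; rewrite req1 expr1n subrr; split.
      by rewrite inner_conj /inner mulmx0 mxE conjC0.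
    by rewrite /inner mulmx0 mxE.
  have r1 : r < 1 by rewrite lt_neqAle rn1.
  have [u [u1 xu]] := orthogonal_vector x (qn r1).
  exists ((Num.sqrt (1 - r ^+ 2))%:C%C *: u).
  rewrite innerZr xu mulr0 inner_real rinnerZl rinnerZr u1 mulr1 -expr2.
  by rewrite sqr_sqrtr // subr_ge0 expr_le1.
exists (inner (A *m x) z).
have zx : inner z x = 0 by rewrite inner_conj xz conjC0.
(* The two points come from e = 1 and e = -1. *)
have inq (e : R[i]) : e * Num.conj e = 1 -> qrange q A
     (inner ((q *: A) *m x) x + Num.conj e * inner (A *m x) z).
  move=> ee; exists x, (Num.conj q *: x + e *: z); split.
  - exact/vnorm_unit.
  - apply/vnorm_unit/complexI; rewrite -inner_real.
    rewrite !(innerDl, innerDr, innerZl, innerZr) xx xz zx zz.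
    rewrite !mulr0 addr0 add0r mulr1 conjCK mulrA [e * _]ee mul1r mulrC.
    rewrite -normCK -normc_norm.
    by rewrite -rmorphXn -rmorphD /= subrKC.
  - by rewrite innerDr !innerZr xx xz conjCK mulr1 mulr0 addr0.
  - by rewrite innerDr !innerZr conjCK -scalemxAl innerZl.
split; first by have := inq 1; rewrite rmorph1 !mul1r; apply.
by have := inq (-1); rewrite rmorphN1 mulrNN !mulN1r mul1r; apply.
Qed.

End RealInner.

(** * Geometry of the sector *)

Lemma sin_acute_ge0 (R : realType) (alpha : R) :
  0 <= alpha -> alpha < pi / 2 -> 0 <= sin alpha.
Proof.
move=> a0 a1; apply: sin_ge0_pi; rewrite a0 /= (le_trans (ltW a1)) //.
by rewrite ler_pdivrMr // ler_peMr ?pi_ge0 // ler1n.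
Qed.

(** On the sector, cos(alpha) |Im z| <= sin(alpha) Re z; squaring and writing
    cos^2 = 1 - sin^2 trades Re z for the modulus. *)
Lemma sector_Im_le (R : realType) (alpha w : R) (z : R[i]) :
  0 <= alpha -> alpha < pi / 2 -> sector alpha z -> Normc.normc z <= w ->
  `|Im z| <= sin alpha * w.
Proof.
move=> a0 a1 [Rez Imz] zw.
have ca : 0 < cos alpha.
  by apply: cos_gt0_pihalf; rewrite a1 andbT (lt_le_trans _ a0) //
    oppr_lt0 divr_gt0 // pi_gt0.
have sa := sin_acute_ge0 a0 a1.
have w0 : 0 <= w by exact: le_trans (normc_ge0 z) zw.
have zw2 : Re z ^+ 2 + Im z ^+ 2 <= w ^+ 2.
  have -> : Re z ^+ 2 + Im z ^+ 2 = Normc.normc z ^+ 2.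
    by case: (z) => a b /=; rewrite sqr_sqrtr // addr_ge0 ?sqr_ge0.
  by rewrite lerXn2r ?nnegrE ?normc_ge0.
have ci : cos alpha * `|Im z| <= sin alpha * Re z.
  have := ler_wpM2l (ltW ca) Imz; rewrite /tan.
  suff -> : cos alpha * (sin alpha / cos alpha * Re z) = sin alpha * Re z by [].
  by field; rewrite gt_eqF.
rewrite -ler_sqr ?nnegrE ?mulr_ge0 // exprMn.
have : (cos alpha * `|Im z|) ^+ 2 <= (sin alpha * Re z) ^+ 2.
  by rewrite lerXn2r ?nnegrE ?mulr_ge0 // ltW.
rewrite !exprMn real_normK ?num_real // cos2sin2.
have := ler_wpM2l (sqr_ge0 (sin alpha)) zw2; lra.
Qed.

(** * The norm bound *)

Theorem corollary4p1 (R : realType) (n : nat) (q : R[i]) (alpha : R)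
  (A : 'M[R[i]]_n)
  (hn : (0 < n)%N)
  (hn2 : Normc.normc q < 1 -> (1 < n)%N)
  (hq0 : 0 < Normc.normc q)
  (hq1 : Normc.normc q <= 1)
  (halpha0 : 0 <= alpha)
  (halpha1 : alpha < pi / 2)
  (hA : qsectorial q alpha A) :
  Normc.normc q ^+ 4 * opnorm (A *m (A ^t*) + (A ^t*) *m A)
    / (2 * (Normc.normc q ^+ 2
            + (Normc.normc q * sin alpha
               + 2 * Num.sqrt (1 - Normc.normc q ^+ 2)) ^+ 2))
  <= qradius q A ^+ 2.
Proof.
set r := Normc.normc q in hq0 hq1 *; set w := qradius q A.
set sa := sin alpha; set s := Num.sqrt _.
have w_ub z : qrange q A z -> Normc.normc z <= w.
  by move=> qz; apply: (ub_le_sup (qrange_bounded q A)); exists z.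
have norm_half (a b c : R) : `|a + b| <= c -> `|a - b| <= c -> `|a| <= c.
  by rewrite !ler_norml => /andP[? ?] /andP[? ?]; apply/andP; split; lra.
have ReB u : rinner u u = 1 -> `|Re (inner ((q *: A) *m u) u)| <= w.
  move=> u1; have [d [/w_ub p /w_ub m]] := qrange_pair A hq1 hn2 u1.
  apply: (norm_half _ (Re d)).
    by rewrite -ReD; apply: le_trans p; apply: Re_le_normc.
  by rewrite -ReN -ReD; apply: le_trans m; apply: Re_le_normc.
have ImB u : rinner u u = 1 -> `|Im (inner ((q *: A) *m u) u)| <= sa * w.
  move=> u1; have [d [p m]] := qrange_pair A hq1 hn2 u1.
  apply: (norm_half _ (Im d)).
    rewrite -ImD; exact: sector_Im_le halpha0 halpha1 (hA _ p) (w_ub _ p).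
  rewrite -ImN -ImD; exact: sector_Im_le halpha0 halpha1 (hA _ m) (w_ub _ m).
have sa0 : 0 <= sa := sin_acute_ge0 halpha0 halpha1.
have s0 : 0 <= s := sqrtr_ge0 _.
have r2 : 0 < r ^+ 2 by rewrite exprn_gt0.
have opA : opnorm (A *m A ^t* + A ^t* *m A)
    <= 2 * (w ^+ 2 + (sa * w) ^+ 2) / r ^+ 2.
  apply: opnorm_anticommutator_le => [u u1|].
    rewrite ler_pdivlMr // mulrC mulrDr.
    have := cartesian_bound u ReB ImB; rewrite u1 mulr1.
    rewrite linearZ /= map_mxZ -!scalemxAl !rinnerZ.
    by rewrite (_ : Normc.normc (Num.conj q) = r) //; apply: normc_conj.
  by rewrite divr_ge0 ?(ltW r2) // mulr_ge0 // addr_ge0 ?sqr_ge0.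
move: opA; rewrite ler_pdivlMr // => opA.
have den : 0 < r ^+ 2 + (r * sa + 2 * s) ^+ 2.
  by rewrite ltr_pwDl ?exprn_gt0 // sqr_ge0.
rewrite ler_pdivrMr ?mulr_gt0 //.
have := ler_wpM2l (ltW r2) opA.
(* Up to the factor 4, this is w^2 times the excess of (r sin(alpha) + 2 s)^2
   over (r sin(alpha))^2. *)
have : 0 <= w ^+ 2 * (r * sa * s + s ^+ 2).
  by rewrite mulr_ge0 ?sqr_ge0 // addr_ge0 ?sqr_ge0 // !mulr_ge0 // ltW.
move: (opnorm _) => N; lra.
Qed.
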